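(* Let $X$ be a topological space, $\sigma : X \rightarrow X$ a homeomorphism, and $A$ a non-zero subalgebra of $C(X)$, invariant both under the induced automorphism $\widetilde{\sigma}: C(X) \rightarrow C(X)$, $\widetilde{\sigma}(f)=f\circ\sigma^{-1}$, and under its inverse. Assume that $A$ separates the points of $X$ and is such that every non-empty open set $U \subseteq X$ is a domain of uniqueness for $A$. Then the following three statements are equivalent: (1) $A$ is maximal abelian in $A \rtimes_{\widetilde{\sigma}} \mathbb{Z}$; (2) $\sigma$ is not of finite order; (3) every non-zero two-sided ideal $I \subseteq A \rtimes_{\widetilde{\sigma}} \mathbb{Z}$ is such that $I \cap A \neq \{0\}$.
   Context: $C(X)$ is the algebra of all continuous complex-valued functions on $X$. Algebras are not assumed to be unital. A non-empty subset of $X$ is a domain of uniqueness for $A$ if every function in $A$ that vanishes on it vanishes on the whole of $X$. The homeomorphism $\sigma$ is of finite order if $\sigma^n=\mathrm{id}_X$ for some integer $n>0$. For an associative commutative complex algebra $A$ and an algebra automorphism $\Psi : A \to A$ (here $\Psi$ is the restriction of $\widetilde{\sigma}$ to $A$), the crossed product $A \rtimes_{\Psi} \mathbb{Z}$ is the associative complex algebra of all finite formal sums $\sum_{n\in\mathbb{Z}} f_n\delta^n$ with $f_n\in A$, with coefficientwise addition and scalar multiplication, and with multiplication determined by $(f_n\delta^n)*(g_m\delta^m)=f_n\cdot\Psi^n(g_m)\,\delta^{n+m}$. The algebra $A$ is identified with the abelian subalgebra $\{f_0\delta^0 : f_0\in A\}$; ''maximal abelian in $A \rtimes_{\widetilde{\sigma}}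 \mathbb{Z}$'' means being a maximal abelian subalgebra. *)

(* Defs.v *)
From HB Require Import structures.
From mathcomp Require Import all_boot all_order all_algebra.
From mathcomp Require Import all_classical all_reals all_analysis.
From mathcomp Require Import complex.

Set Implicit Arguments.
Unset Strict Implicit.
Unset Printing Implicit Defensive.

Import Order.TTheory GRing.Theory Num.Theory.
Import numFieldNormedType.Exports.

Local Open Scope classical_set_scope.
Local Open Scope ring_scope.

(* MathComp has no structure of non-unital algebra: a non-unital algebra is
   given here by a product [mul] on an lmodType [V], and its subalgebras,
   ideals, ... are subsets of [V].  Subalgebras and ideals are always linear
   subspaces and need not contain a unit. *)
Section NonUnitalAlgebra.
Context {K : pzRingType} {V : lmodType K}.
Variable mul : V -> V -> V.
Implicit Types B S T I : set V.

Definition linear_subspace S :=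
  [/\ S 0, (forall a b, S a -> S b -> S (a + b))
    & (forall (c : K) a, S a -> S (c *: a))].

Definition subalgebra S :=
  linear_subspace S /\ (forall a b, S a -> S b -> S (mul a b)).

Definition commutative_on S := forall a b, S a -> S b -> mul a b = mul b a.

Definition abelian_subalgebra B S :=
  [/\ S `<=` B, subalgebra S & commutative_on S].

Definition maximal_abelian B S :=
  abelian_subalgebra B S /\
  (forall T, abelian_subalgebra B T -> S `<=` T -> T = S).

Definition two_sided_ideal B I :=
  [/\ I `<=` B, linear_subspace I
    & (forall b a, B b -> I a -> I (mul b a) /\ I (mul a b))].

End NonUnitalAlgebra.

Section CrossedProduct.

(* [iterz f fV n] is the n-th power of [f], given its inverse [fV]. *)
Definition iterz (T : Type) (f fV : T -> T) (n : int) : T -> T :=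
  match n with Posz k => iter k f | Negz k => iter k.+1 fV end.

Variables (F : pzRingType) (Psi PsiV : F -> F).
Implicit Types (A : set F) (a b : int -> F) (f g : F).

(* The formal sum [\sum_n a_n delta^n] is encoded by its coefficients
   [a : int -> F]. *)
Definition crossed_product A : set (int -> F) :=
  [set a | (forall n, A (a n)) /\ finite_set [set n | a n != 0]].

Definition monomial f (n : int) : int -> F := fun k => if k == n then f else 0.

Definition crossed_mul a b : int -> F :=
  fun n => \sum_(k \in [set: int]) (a k * iterz Psi PsiV k (b (n - k))).

(* The defining rule (f delta^n) * (g delta^m) = f Psi^n(g) delta^(n + m). *)
Lemma crossed_mul_monomial f g (n m : int) : Psi 0 = 0 -> PsiV 0 = 0 ->
  crossed_mul (monomial f n) (monomial g m) =
  monomial (f * iterz Psi PsiV n g) (n + m).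
Proof.
move=> Psi0 PsiV0; apply/funext => k; rewrite /crossed_mul /monomial.
have it0 (p : int) : iterz Psi PsiV p 0 = 0.
  by case: p => p; elim: p => //= p ->.
rewrite -(fsbig_widen [set n] setT)//=; last first.
  by move=> i [_ /= /eqP/negbTE ->]; rewrite mul0r.
rewrite fsbig_set1 eqxx subr_eq addrC.
by case: eqP => // _; rewrite it0 mulr0.
Qed.

Definition base_subalgebra A : set (int -> F) :=
  [set monomial f 0 | f in A].

End CrossedProduct.

(* [R[i]^o] is [R[i]] with the topology of its modulus; [R[i]] itself carries no
   canonical topology. *)
Section Functions.
Context {R : realType} {X : topologicalType}.
Implicit Types (A : set (X -> R[i]^o)) (S : set X).

Definition continuous_functions : set (X -> R[i]^o) :=
  [set f | continuous f].

Definition pointwise_mul (f g : X -> R[i]^o) : X -> R[i]^o := f \* g.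

Definition precomp (phi : X -> X) (f : X -> R[i]^o) : X -> R[i]^o := f \o phi.

Definition separates_points A :=
  forall x y : X, x <> y -> exists2 f, A f & f x <> f y.

Definition domain_of_uniqueness A S :=
  S !=set0 /\
  (forall f, A f -> (forall x, S x -> f x = 0) -> forall x, f x = 0).

End Functions.

Definition finite_order (X : Type) (sigma : X -> X) :=
  exists2 n : nat, (0 < n)%N & iter n sigma = id.

(* Main.v *)
Require Import Defs.
From mathcomp Require Import all_boot all_order all_algebra.
From mathcomp Require Import all_classical all_reals all_analysis.
From mathcomp Require Import complex.

Import Order.TTheory GRing.Theory Num.Theory.
Import numFieldNormedType.Exports.

Local Open Scope classical_set_scope.
Local Open Scope ring_scope.

(** Comparing coefficients, an element [a] of the crossed product commutes with
    [A] iff [g * a k = a k * (g \o sigma^-k)] for all [k] and all [g] in [A].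
    A function of [A] is determined by its values on any non-empty open set, so
    [A] has cancellation: if [a k <> 0], its non-vanishing set is open and
    non-empty, and [g] and [g \o sigma^-k] agree on it, hence everywhere.  As [A]
    separates points, [sigma^k = id].  Thus the commutant of [A] consists of the
    sums supported on the periods [k] of [sigma] ([isotropicP]).  On such sums the
    action is invisible in the product, so the commutant is itself commutative;
    it is therefore the only maximal abelian subalgebra containing [A]
    ([isotropic_maximal_abelian]), and [A] is maximal abelian iff it equals its
    commutant, i.e. iff [sigma] has no nonzero period ([maximal_abelian_base]).

    For ideals, a nonzero element of minimal support length in a nonzero ideal,
    translated so that its coefficient at [0] is nonzero, must commute with [A]:
    a commutator with [f] in [A] stays in the ideal and loses the index [0].
    Hence every nonzero ideal meets the commutant ([ideal_meets_isotropic]), which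
    is [A] when [sigma] has infinite order.  Conversely, if [sigma^m = id] with
    [m <> 0], then [delta^m] is central, and the elements [a - a * delta^m] form a
    nonzero ideal ([sub_translate_ideal]).  It meets [A] trivially: an element of
    the intersection would force [a] to be constant along the multiples of [m] on
    either side of [0], and [a] has finite support ([sub_translate_monomial]). *)

(** * Integer powers of a bijection *)

Section IntegerPowers.
Context {T : Type} {f fV : T -> T}.
Hypotheses (fK : cancel f fV) (fVK : cancel fV f).

Lemma iter_cancel n : cancel (iter n f) (iter n fV).
Proof. by elim: n => [//|n IHn] x; rewrite iterSr iterS fK IHn. Qed.

Lemma iterzS (n : int) x : iterz f fV (n + 1) x = f (iterz f fV n x).
Proof.
case: n => n; first by rewrite -PoszD addn1.
transitivity (iterz f fV (- n%:Z) x).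
  by congr (iterz f fV _ x); rewrite NegzE -addn1 PoszD opprD addrNK.
by case: n => [|n]; rewrite ?oppr0 -?NegzE /= fVK.
Qed.

Lemma iterzB1 (n : int) x : iterz f fV (n - 1) x = fV (iterz f fV n x).
Proof. by rewrite -[in RHS](subrK 1 n) iterzS fK. Qed.

Lemma iterzD (m n : int) x :
  iterz f fV (m + n) x = iterz f fV m (iterz f fV n x).
Proof.
elim/int_ind: m => [|m IHm|m IHm]; first by rewrite add0r.
  by rewrite -addn1 PoszD addrAC !iterzS IHm.
by rewrite -addn1 PoszD opprD addrAC !iterzB1 IHm.
Qed.

End IntegerPowers.

Lemma finite_order_iterz (T : Type) (s sV : T -> T) :
  cancel s sV -> cancel sV s ->
  finite_order s <-> exists2 k : int, k != 0 & iterz sV s k = id.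
Proof.
move=> sK sVK; split=> [[n n_gt0 sn1]|[[n|n] /= n_neq0 sn1]].
- exists (Posz n); first by rewrite eqz_nat -lt0n.
  by apply/funext => x /=; rewrite -[RHS](iter_cancel sK n) sn1.
- exists n; first by rewrite lt0n.
  by apply/funext => x; rewrite -[RHS](iter_cancel sVK n) sn1.
- by exists n.+1.
Qed.

(** * Convolution of finitely supported families *)

Lemma subfctE (T : Type) (V : zmodType) (u v : T -> V) x :
  (u - v) x = u x - v x.
Proof. by []. Qed.

Section Convolution.
Context {F : pzRingType} {Psi PsiV : F -> F}.
Implicit Types (A : set F) (a b c : int -> F) (f g : F).
Local Notation mul := (crossed_mul Psi PsiV).
Local Notation act := (iterz Psi PsiV).
Local Notation supp a := [set n : int | a n != 0].

(** The finite set of indices need not be the exact support, so that the products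
    of several elements can be compared over one common set. *)
Lemma crossed_mul_finE (s : seq int) a b n : uniq s ->
  (forall k, k \notin s -> a k = 0) ->
  mul a b n = \sum_(k <- s) a k * act k (b (n - k)).
Proof.
move=> s_uniq a_s; rewrite /crossed_mul (fsbigE s) //=.
  by under eq_bigl do rewrite in_setT.
by move=> k _ /a_s ->; rewrite mul0r.
Qed.

Lemma finite_supp_seq a : finite_set (supp a) ->
  exists2 s : seq int, uniq s & forall k, k \notin s -> a k = 0.
Proof.
move=> /finite_seqP[s Es]; exists (undup s); first exact: undup_uniq.
move=> k; rewrite mem_undup => ks; apply: contrapT => /eqP ak.
by have : supp a k by []; rewrite Es /= (negbTE ks).
Qed.

Lemma crossed_mul_monomiall f n b k :
  mul (monomial f n) b k = f * act n (b (k - n)).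
Proof.
rewrite (@crossed_mul_finE [:: n]) // ?big_seq1 /monomial ?eqxx // => j.
by rewrite inE => /negbTE ->.
Qed.

Hypothesis act0 : forall k, act k 0 = 0.

Lemma crossed_mul_monomialr a g m k :
  mul a (monomial g m) k = a (k - m) * act (k - m) g.
Proof.
rewrite /crossed_mul -(fsbig_widen [set k - m] setT) //=; last first.
  move=> j [_ /= j_neq]; rewrite /monomial.
  case: (k - j =P m) => [mE|_]; last by rewrite act0 mulr0.
  by case: j_neq; rewrite -mE subKr.
by rewrite fsbig_set1 /monomial subKr eqxx.
Qed.

Lemma crossed_mul_supp a b n : mul a b n != 0 ->
  exists k, a k != 0 /\ b (n - k) != 0.
Proof.
move=> /eqP ab_n; apply: contrapT => /forallNP none; apply: ab_n.
rewrite /crossed_mul fsbig1 // => k _; have [->|ak] := eqVneq (a k) 0.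
  by rewrite mul0r.
have [->|bk] := eqVneq (b (n - k)) 0; first by rewrite act0 mulr0.
by case: (none k).
Qed.

Lemma crossed_product_mul A a b : A 0 ->
  (forall f g, A f -> A g -> A (f + g)) ->
  (forall f g, A f -> A g -> A (f * g)) ->
  (forall k f, A f -> A (act k f)) ->
  crossed_product A a -> crossed_product A b -> crossed_product A (mul a b).
Proof.
move=> A0 AD AM Aact [Aa fin_a] [Ab fin_b]; split=> [n|].
  have [s s_uniq a_s] := finite_supp_seq _ fin_a.
  rewrite (crossed_mul_finE _ _ _ _ s_uniq a_s).
  by apply: big_ind => // k _; apply/AM/Aact.
apply: (@sub_finite_set _ _ [set k + l | k in supp a & l in supp b]).
  move=> n /= /crossed_mul_supp[k [ak bk]].
  by exists k => //; exists (n - k) => //; rewrite addrC subrK.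
exact: finite_image2.
Qed.

Lemma crossed_mulBr a b c :
  (forall k, {morph act k : f g / f - g}) -> finite_set (supp a) ->
  mul a (b - c) = mul a b - mul a c.
Proof.
move=> actB /finite_supp_seq[s s_uniq a_s]; apply/funext => n.
rewrite subfctE !(crossed_mul_finE s) // -sumrB.
by apply: eq_bigr => k _; rewrite subfctE actB mulrBr.
Qed.

Lemma crossed_mulBl a b c : finite_set (supp a) -> finite_set (supp b) ->
  mul (a - b) c = mul a c - mul b c.
Proof.
move=> fin_a fin_b.
have [s s_uniq ab_s] : exists2 s : seq int, uniq s &
    forall k, k \notin s -> a k = 0 /\ b k = 0.
  have [s _ a_s] := finite_supp_seq _ fin_a.
  have [t _ b_t] := finite_supp_seq _ fin_b.
  exists (undup (s ++ t)); first exact: undup_uniq.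
  by move=> k; rewrite mem_undup mem_cat negb_or => /andP[/a_s -> /b_t ->].
apply/funext => n; rewrite subfctE !(crossed_mul_finE s) //.
- by rewrite -sumrB; apply: eq_bigr => k _; rewrite -mulrBl.
- by move=> k /ab_s[].
- by move=> k /ab_s[].
- by move=> k /ab_s[ak bk]; rewrite subfctE ak bk subrr.
Qed.

(** This is [a * delta^m], which makes sense although [delta^m] itself lies in the
    crossed product only when the algebra has a unit. *)
Definition translate m a : int -> F := fun k => a (k - m).

Lemma translate_supp m a :
  finite_set (supp a) -> finite_set (supp (translate m a)).
Proof.
move=> fin_a; apply: (@sub_finite_set _ _ [set k + m | k in supp a]).
  by move=> k /= ak; exists (k - m) => //; rewrite subrK.
exact: finite_image.
Qed.

Lemma crossed_mul_translater m a b :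
  mul a (translate m b) = translate m (mul a b).
Proof.
apply/funext => n; apply: eq_fsbigr => k _.
by rewrite /translate addrAC.
Qed.

(** When [m] acts trivially, [delta^m] is central: it can also be moved out of
    the left factor. *)
Lemma crossed_mul_translatel m a b : (forall k, act (k + m) =1 act k) ->
  mul (translate m a) b = translate m (mul a b).
Proof.
move=> act_m; apply/funext => n; rewrite /translate /crossed_mul.
rewrite (@reindex_fsbigT _ _ _ _ _ (fun k => k + m)) /=; last first.
  by exists (fun k => k - m) => k; rewrite (addrK, subrK).
by apply: eq_fsbigr => k _; rewrite addrK act_m opprD addrA [n - m - k]addrAC.
Qed.

(** The values at the infinitely many nonnegative multiples of [m] coincide, so
    they cannot all lie in the support. *)
Lemma finite_supp_periodic_eq0 m a : m != 0 -> finite_set (supp a) ->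
  (forall j : nat, a (m *+ j.+1) = a (m *+ j)) -> a 0 = 0.
Proof.
move=> m_neq0 fin_a a_per; apply: contrapT => /eqP a0; apply: infinite_nat.
have a_j j : a (m *+ j) = a 0 by elim: j => [|j IHj]; rewrite ?mulr0n ?a_per.
have -> : [set: nat] = GRing.natmul m @^-1` supp a.
  by apply/seteqP; split=> // j _ /=; rewrite a_j.
by apply: finite_preimage fin_a => i j _ _; exact: mulrIn.
Qed.

(** Away from [0] the equation says that [a] has the same value at [k] and at
    [k - m].  Going up from [0] gives [a 0 = 0], going down from [- m] gives
    [a (- m) = 0], and [f] is the difference of these two values. *)
Lemma sub_translate_monomial m a f : m != 0 -> finite_set (supp a) ->
  a - translate m a = monomial f 0 -> f = 0.
Proof.
move=> m_neq0 fin_a a_f.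
have a_per k : k != 0 -> a k = a (k - m).
  move=> k_neq0; apply/subr0_eq; rewrite -[a (k - m)]/(translate m a k).
  by rewrite -subfctE a_f /monomial (negbTE k_neq0).
have mM_neq0 j : m *+ j.+1 != 0 by rewrite mulrn_eq0.
have a0 : a 0 = 0.
  apply: (finite_supp_periodic_eq0 m) => // j.
  by rewrite a_per // mulrSr addrK.
(* [translate m a 0] is [a (- m)], so the period is now taken to be [- m]. *)
have am : translate m a 0 = 0.
  apply: (finite_supp_periodic_eq0 (- m)); rewrite ?oppr_eq0 //.
    exact: translate_supp.
  move=> j; rewrite /translate mulrSr -a_per // -[- m *+ j - m]mulrSr.
  by rewrite mulNrn oppr_eq0.
have := congr1 (fun u => u 0) a_f.
by rewrite subfctE a0 am subrr /monomial eqxx.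
Qed.

(** Where the action is trivial the product is an ordinary convolution, which is
    symmetric under the reindexing [k |-> n - k]. *)
Lemma crossed_mulC a b : (forall f g, f * g = g * f) ->
  (forall k, a k != 0 -> act k =1 id) -> (forall k, b k != 0 -> act k =1 id) ->
  mul a b = mul b a.
Proof.
move=> mulC act_a act_b; apply/funext => n; rewrite /crossed_mul.
rewrite (@reindex_fsbigT _ _ _ _ _ (fun k => n - k)) /=; last first.
  by exists (fun k => n - k) => k; rewrite opprB addrC subrK.
apply: eq_fsbigr => k _; rewrite subKr.
have [->|/act_b ->] := eqVneq (b k) 0; first by rewrite mul0r act0 mulr0.
have [->|/act_a ->] := eqVneq (a (n - k)) 0; first by rewrite mul0r mulr0.
exact: mulC.
Qed.

End Convolution.

(** * Crossed products of function algebras *)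

Lemma linear_subspaceB (K : pzRingType) (V : lmodType K) (S : set V) u v :
  linear_subspace S -> S u -> S v -> S (u - v).
Proof. by move=> [_ SD SZ] Su Sv; rewrite -scaleN1r; exact/SD/SZ. Qed.

Section FunctionAlgebra.
Context {R : realType} {X : topologicalType} {sigma sigmaV : X -> X}.
Context {A : set (X -> R[i]^o)}.
Hypotheses (sigmaK : cancel sigma sigmaV) (sigmaVK : cancel sigmaV sigma).
Hypothesis A_subalg : subalgebra pointwise_mul A.
Hypothesis A_invariant : forall f, A f -> A (precomp sigmaV f).
Hypothesis A_invariantV : forall f, A f -> A (precomp sigma f).
Local Notation F := (X -> R[i]^o).
Local Notation act := (iterz (@precomp R X sigmaV) (precomp sigma)).
Local Notation tau := (iterz sigmaV sigma).
Local Notation mul := (crossed_mul (@precomp R X sigmaV) (precomp sigma)).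
Local Notation AxZ := (crossed_product A).
Local Notation A0 := (base_subalgebra A).
Implicit Types (f g : F) (a b : int -> F).

Let A_zero : A 0. Proof. by case: A_subalg => -[]. Qed.
Let A_add f g : A f -> A g -> A (f + g).
Proof. by case: A_subalg => -[_ AD _] _; exact: AD. Qed.
Let A_scale (c : R[i]) f : A f -> A (c *: f).
Proof. by case: A_subalg => -[_ _ AZ] _; exact: AZ. Qed.
Let A_mul f g : A f -> A g -> A (f * g).
Proof. by case: A_subalg => _; exact. Qed.

Lemma iterz_precomp n f : act n f = precomp (tau n) f.
Proof.
have iter_precomp (s : X -> X) m : iter m (precomp s) f = precomp (iter m s) f.
  elim: m => [|m IHm] //; rewrite iterS IHm; apply/funext => x.
  by rewrite /precomp /= -iterSr.
by case: n => n; exact: iter_precomp.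
Qed.

Let act0 k : act k 0 = 0. Proof. by rewrite iterz_precomp. Qed.
Let actB k : {morph act k : f g / f - g}.
Proof. by move=> f g; rewrite !iterz_precomp. Qed.

Let A_act k f : A f -> A (act k f).
Proof.
have A_iter phi m : (forall g, A g -> A (phi g)) -> A f -> A (iter m phi f).
  by move=> A_phi Af; elim: m => // m; exact: A_phi.
by case: k => n; exact: A_iter.
Qed.

Lemma crossed_product_linear : linear_subspace AxZ.
Proof.
split.
- split=> // ; apply: (@sub_finite_set _ _ set0) => //= n /=.
  by rewrite eqxx.
- move=> a b [Aa fin_a] [Ab fin_b]; split=> [n|]; first exact: A_add.
  apply: sub_finite_set (_ : finite_set ([set n | a n != 0] `|`
    [set n | b n != 0])).
    move=> n /= abn; apply: contrapT => /not_orP[] /negP + /negP.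
    rewrite !negbK => /eqP an /eqP bn.
    by move: abn; rewrite addrfctE /= an bn addr0 eqxx.
  by rewrite finite_setU.
- move=> c a [Aa fin_a]; split=> [n|]; first exact: A_scale.
  apply: sub_finite_set fin_a => n /=; apply: contra_neq => an.
  by rewrite scalrfctE /= an scaler0.
Qed.

Lemma monomial_in f n : A f -> AxZ (monomial f n).
Proof.
move=> Af; split=> [k|]; first by rewrite /monomial; case: eqP.
apply: (sub_finite_set _ (finite_set1 n)) => k /=; rewrite /monomial.
by case: (k =P n) => // _; rewrite eqxx.
Qed.

Lemma base_subalgebraP a : AxZ a ->
  A0 a <-> (forall k, k != 0 -> a k = 0).
Proof.
move=> [Aa _]; split=> [[f _ <-] k /negbTE k0|a0].
  by rewrite /monomial k0.
exists (a 0) => //; apply/funext => k; rewrite /monomial.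
by case: eqP => [->//|/eqP /a0].
Qed.

Let AxZ_mul a b : AxZ a -> AxZ b -> AxZ (mul a b).
Proof. exact: crossed_product_mul. Qed.

Hypothesis A_cont : A `<=` continuous_functions.
Hypothesis A_neq0 : exists2 f, A f & f <> 0.
Hypothesis A_sep : separates_points A.
Hypothesis A_uniq : forall U : set X,
  open U -> U !=set0 -> domain_of_uniqueness A U.

Lemma nonvanishing_open f : continuous f -> open [set x | f x != 0].
Proof.
move=> f_cont.
have -> : [set x | f x != 0] = f @^-1` (~` [set 0]).
  by apply/seteqP; split=> x /= /eqP.
apply: open_comp => [x _|]; first exact: f_cont.
apply/closed_openC/accessible_closed_set1.
exact/hausdorff_accessible/norm_hausdorff.
Qed.

(** The difference [g - h] lies in [A] and vanishes on the open set where [f] does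
    not, which is a domain of uniqueness. *)
Lemma function_algebra_mulIf f g h : A f -> f != 0 -> A g -> A h ->
  f * g = f * h -> g = h.
Proof.
move=> Af /eqP f_neq0 Ag Ah fg_fh; apply/subr0_eq/funext.
have [|_ uniq] := A_uniq _ (nonvanishing_open _ (A_cont _ Af)).
  apply: contrapT => /forallNP f0; apply/f_neq0/funext => x.
  by apply: contrapT => /eqP; exact: f0.
apply: uniq => [|x /= fx]; first exact: linear_subspaceB A_subalg.1 Ag Ah.
apply/eqP; rewrite subfctE subr_eq0; apply/eqP/(mulfI fx).
exact: (congr1 (fun u : F => u x) fg_fh).
Qed.

Lemma function_algebra_mul_neq0 f g :
  A f -> A g -> f != 0 -> g != 0 -> f * g != 0.
Proof.
move=> Af Ag f_neq0; apply: contra_neq => fg0.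
by apply: (function_algebra_mulIf _ _ _ Af f_neq0) => //; rewrite mulr0.
Qed.

(** Cancelling [f] shows that every [g] in [A] is invariant under [tau k], and [A]
    separates points. *)
Lemma commuting_coefficient f k : A f -> f != 0 ->
  (forall g, A g -> g * f = f * act k g) -> tau k = id.
Proof.
move=> Af f_neq0 comm; apply/funext => x; apply: contrapT => /A_sep[g Ag]; apply.
suff -> : g (tau k x) = act k g x.
  congr (_ x); apply: (function_algebra_mulIf _ _ _ Af f_neq0) => //.
    exact: A_act.
  by rewrite -comm // mulrC.
by rewrite iterz_precomp.
Qed.

(** * The commutant of the function algebra *)

(** The commutant of [A] in the crossed product, described through supports; see
    [isotropicP]. *)
Definition isotropic : set (int -> F) :=
  [set a | AxZ a /\ forall k, a k != 0 -> tau k = id].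

Let act_id k : tau k = id -> act k =1 id.
Proof. by move=> tau_k f; rewrite iterz_precomp tau_k. Qed.

Lemma isotropicP a : AxZ a ->
  isotropic a <-> (forall f, A f -> mul (monomial f 0) a = mul a (monomial f 0)).
Proof.
move=> AxZa; split=> [[_ a_iso] f Af|comm]; last first.
  split=> // k ak; apply: (commuting_coefficient (a k)) => // [|g Ag].
    by case: AxZa.
  have := congr1 (fun u : int -> F => u k) (comm g Ag).
  by rewrite crossed_mul_monomiall crossed_mul_monomialr // subr0.
apply: crossed_mulC => // [f1 f2|k|k /a_iso]; first exact: mulrC.
- rewrite /monomial; case: (k =P 0) => [->|_]; last by rewrite eqxx.
  by move=> _; exact: act_id.
- exact: act_id.
Qed.

Lemma base_subalgebra_isotropic : A0 `<=` isotropic.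
Proof.
move=> _ [f Af <-]; split; first exact: monomial_in.
by move=> k; rewrite /monomial; case: (k =P 0) => [->|_] //; rewrite eqxx.
Qed.

(** Any abelian subalgebra containing [isotropic] contains [A], so its elements
    commute with [A] and are isotropic. *)
Lemma isotropic_maximal_abelian : maximal_abelian mul AxZ isotropic.
Proof.
have [AxZ0 AxZD AxZZ] := crossed_product_linear.
split.
  split=> [a []//||a b [_ a_iso] [_ b_iso]]; last first.
    apply: crossed_mulC => // [f g|k /a_iso|k /b_iso]; first exact: mulrC.
    + exact: act_id.
    + exact: act_id.
  split; first split.
  - by split=> // k; rewrite eqxx.
  - move=> a b [AxZa a_iso] [AxZb b_iso]; split=> [|k]; first exact: AxZD.
    rewrite addrfctE /=; have [->|/a_iso//] := eqVneq (a k) 0.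
    by rewrite add0r => /b_iso.
  - move=> c a [AxZa a_iso]; split=> [|k]; first exact: AxZZ.
    rewrite scalrfctE /=; have [->|/a_iso//] := eqVneq (a k) 0.
    by rewrite scaler0 eqxx.
  - move=> a b [AxZa a_iso] [AxZb b_iso]; split=> [|k]; first exact: AxZ_mul.
    move=> /(crossed_mul_supp act0)[j [/a_iso tau_j /b_iso tau_kj]].
    apply/funext => x; rewrite -[k](subrK j) addrC.
    by rewrite (iterzD sigmaVK sigmaK) tau_j tau_kj.
move=> T [T_AxZ _ T_comm] iso_T; apply/seteqP; split=> // a Ta.
apply/isotropicP => [|f Af]; first exact: T_AxZ.
apply: T_comm => //; apply/iso_T/base_subalgebra_isotropic.
by exists f.
Qed.

(** A nonzero period [k] produces the isotropic element [f delta^k], which is not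
    in [A]. *)
Lemma isotropic_subset_base :
  (isotropic `<=` A0) <-> (forall k, tau k = id -> k = 0).
Proof.
split=> [iso_A0 k tau_k|tau_free a [AxZa a_iso]]; last first.
  apply/base_subalgebraP => // k; apply: contra_neq_eq => /a_iso.
  exact: tau_free.
have [f Af /eqP f_neq0] := A_neq0; apply: contrapT => /eqP k_neq0.
have fk_in := monomial_in _ k Af.
have /(base_subalgebraP _ fk_in)/(_ k k_neq0) : A0 (monomial f k).
  apply: iso_A0; split=> // j; rewrite /monomial.
  by case: (j =P k) => [->|_] //; rewrite eqxx.
by rewrite /monomial eqxx => /eqP; rewrite (negbTE f_neq0).
Qed.

Lemma maximal_abelian_base :
  maximal_abelian mul AxZ A0 <-> (forall k, tau k = id -> k = 0).
Proof.
rewrite -isotropic_subset_base; split=> [[_ max]|iso_A0].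
  have [iso_abelian _] := isotropic_maximal_abelian.
  by rewrite (max _ iso_abelian base_subalgebra_isotropic).
have -> : A0 = isotropic.
  by apply/seteqP; split=> //; exact: base_subalgebra_isotropic.
exact: isotropic_maximal_abelian.
Qed.

(** * Intersection of ideals with the function algebra *)

Lemma act_neq0 k f : f != 0 -> act k f != 0.
Proof.
apply: contra_neq; rewrite iterz_precomp => tau_f0; apply/funext => x.
have := congr1 (fun u : F => u (tau (- k) x)) tau_f0.
by rewrite /precomp /= -(iterzD sigmaVK sigmaK) subrr.
Qed.

(** The induction is on the length of a list of indices containing the support
    of [a]: either a suitable translate of [a] commutes with [A], or one of its
    commutators with [A] is a nonzero element of [I] of smaller support. *)
Lemma ideal_meets_isotropic I a : two_sided_ideal mul AxZ I ->
  I a -> a <> 0 -> exists2 b, I b /\ isotropic b & b <> 0.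
Proof.
move=> [I_AxZ I_lin I_mul] Ia a_neq0.
have [s _ a_s] := finite_supp_seq _ (I_AxZ _ Ia).2.
have [N] := ubnP (size s); elim: N => // N IHN in s a Ia a_neq0 a_s *.
rewrite ltnS => s_le.
have [m am] : exists m, a m != 0.
  apply: contrapT => /forallNP a0; apply/a_neq0/funext => k.
  by apply: contrapT => /eqP; exact: a0.
have [g Ag /eqP g_neq0] := A_neq0.
(* The exponent [- m] moves the nonzero coefficient at [m] to the index [0]. *)
pose b := mul a (monomial g (- m)).
have bE k : b k = a (k + m) * act (k + m) g.
  by rewrite /b crossed_mul_monomialr // opprK.
have b0 : b 0 != 0.
  rewrite bE add0r; apply: function_algebra_mul_neq0 => //.
  - by case: (I_AxZ _ Ia).
  - exact: A_act.
  - exact: act_neq0.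
have Ib : I b by case: (I_mul _ _ (monomial_in _ (- m) Ag) Ia).
pose t := [seq k - m | k <- s].
have b_t k : k \notin t -> b k = 0.
  move=> kt; rewrite bE a_s ?mul0r //; apply: contra kt => ks.
  by apply/mapP; exists (k + m); rewrite ?addrK.
have [b_iso|/(isotropicP _ (I_AxZ _ Ib)) /existsNP[f /not_implyP[Af comm]]] :=
    pselect (isotropic b).
  by exists b => // bE0; rewrite bE0 eqxx in b0.
(* The coefficient of [c] at [k] is [f * b k - b k * act k f], which is zero at
   [k = 0]: the list of indices loses [0]. *)
pose c := mul (monomial f 0) b - mul b (monomial f 0).
have [I_fb I_bf] := I_mul _ _ (monomial_in _ 0 Af) Ib.
apply: (IHN [seq k <- t | k != 0] c).
- exact: linear_subspaceB.
- by move=> /subr0_eq.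
- move=> k; rewrite mem_filter negb_and negbK /c subfctE.
  rewrite crossed_mul_monomiall crossed_mul_monomialr // subr0.
  case/orP => [/eqP -> /=|/b_t ->]; first by rewrite mulrC subrr.
  by rewrite iterz_precomp mulr0 mul0r subrr.
- apply: leq_trans s_le; rewrite -(size_map (fun k => k - m) s) -/t.
  rewrite size_filter -(count_predC (fun k => k != 0) t) -addn1 leq_add2l.
  rewrite -has_count; apply/hasP; exists 0; last by [].
  by apply: contraNT b0 => /b_t ->.
Qed.

(** This is the ideal generated by [1 - delta^m], written so as to make sense
    without a unit; it is two-sided because [delta^m] is central. *)
Lemma sub_translate_ideal m : tau m = id ->
  two_sided_ideal mul AxZ [set a - translate m a | a in AxZ].
Proof.
move=> tau_m; have AxZ_lin := crossed_product_linear.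
have AxZ_translate a : AxZ a -> AxZ (translate m a).
  by move=> [Aa fin_a]; split=> [k|]; [exact: Aa|exact: translate_supp].
split.
- by move=> _ [a AxZa <-]; apply: linear_subspaceB => //; exact: AxZ_translate.
- have [AxZ0 AxZD AxZZ] := AxZ_lin; split.
  + by exists 0 => //; rewrite /translate subrr.
  + move=> _ _ [a AxZa <-] [b AxZb <-]; exists (a + b); first exact: AxZD.
    by rewrite addrACA -opprD.
  + move=> c _ [a AxZa <-]; exists (c *: a); first exact: AxZZ.
    by rewrite scalerBr.
- move=> b _ AxZb [a AxZa <-]; split.
    exists (mul b a); first exact: AxZ_mul.
    by rewrite crossed_mulBr ?crossed_mul_translater //; case: AxZb.
  exists (mul a b); first exact: AxZ_mul.
  rewrite crossed_mulBl; [|by case: AxZa|by apply: translate_supp; case: AxZa].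
  rewrite (crossed_mul_translatel m) // => k f.
  by rewrite !iterz_precomp; congr (precomp _ f); apply/funext => x;
     rewrite (iterzD sigmaVK sigmaK) tau_m.
Qed.

Lemma ideal_intersection_base :
  (forall I, two_sided_ideal mul AxZ I -> I <> [set 0] -> I `&` A0 <> [set 0]) <->
  (forall k, tau k = id -> k = 0).
Proof.
split=> [meets m tau_m|/isotropic_subset_base iso_A0 I I_ideal I_neq0 IA0].
  apply: contrapT => /eqP m_neq0.
  have I_ideal := sub_translate_ideal m tau_m.
  have [g Ag g_neq0] := A_neq0.
  apply: (meets _ I_ideal) => [I0|].
    have : [set a - translate m a | a in AxZ]
        (monomial g 0 - translate m (monomial g 0)).
      by exists (monomial g 0) => //; exact: monomial_in.
    rewrite I0 => /= /(congr1 (fun u : int -> F => u 0)).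
    rewrite subfctE /translate /monomial eqxx sub0r oppr_eq0 (negbTE m_neq0).
    by rewrite subr0.
  have monomial0 : monomial (0 : F) 0 = 0.
    by apply/funext => k; rewrite /monomial; case: (k =P 0).
  apply/seteqP; split=> [_ [[a [_ fin_a] <-] [f _ fE]]|_ ->] /=.
    have f0 : f = 0 by apply: (sub_translate_monomial m a).
    by rewrite -fE f0.
  have [_ [I_0 _ _] _] := I_ideal; split=> //.
  by exists 0.
have [_ [I_0 _ _] _] := I_ideal.
have [a Ia a_neq0] : exists2 a, I a & a <> 0.
  apply: contrapT => none; apply: I_neq0; apply/seteqP; split=> [a Ia|_ ->//] /=.
  by apply: contrapT => a_neq0; apply: none; exists a.
have [b [Ib b_iso]] := ideal_meets_isotropic _ _ I_ideal Ia a_neq0; apply.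
have : (I `&` A0) b by split=> //; exact: iso_A0.
by rewrite IA0.
Qed.

End FunctionAlgebra.

(** * The equivalence *)

Theorem theorem4p6 (R : realType) (X : topologicalType)
    (sigma sigmaV : X -> X)
    (sigmaK : cancel sigma sigmaV) (sigmaVK : cancel sigmaV sigma)
    (sigma_cont : continuous sigma) (sigmaV_cont : continuous sigmaV)
    (A : set (X -> R[i]^o))
    (A_cont : A `<=` continuous_functions)
    (A_subalg : subalgebra pointwise_mul A)
    (A_neq0 : exists2 f, A f & f <> 0)
    (A_invariant : forall f, A f -> A (precomp sigmaV f))
    (A_invariantV : forall f, A f -> A (precomp sigma f))
    (A_sep : separates_points A)
    (A_uniq : forall U : set X, open U -> U !=set0 -> domain_of_uniqueness A U) :
  let mul := crossed_mul (precomp sigmaV) (precomp sigma) in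
  let AxZ := crossed_product A in
  let A0 := base_subalgebra A in
  (maximal_abelian mul AxZ A0 <-> ~ finite_order sigma) /\
  (~ finite_order sigma <->
   forall I, two_sided_ideal mul AxZ I -> I <> [set 0] -> I `&` A0 <> [set 0]).
Proof.
move=> mul AxZ A0.
have free_iff : ~ finite_order sigma <->
    forall k, iterz sigmaV sigma k = id -> k = 0.
  rewrite (finite_order_iterz _ _ _ sigmaK sigmaVK); split=> [no_k k tau_k|free [k]].
    by apply: contrapT => /eqP k_neq0; apply: no_k; exists k.
  by move=> /eqP k_neq0 /free.
rewrite free_iff; split; first exact: maximal_abelian_base.
by apply: iff_sym; exact: ideal_intersection_base.
Qed.
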